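(* Let $(X,d,W)$ be a complete $UCW$-hyperbolic space, $C\subseteq X$ a nonempty bounded convex closed subset and $T:C\to C$ nonexpansive. Then $T$ has fixed points.
   Context: A $W$-hyperbolic space $(X,d,W)$ is a metric space $(X,d)$ with a map $W:X\times X\times[0,1]\to X$ such that for all $x,y,z,w\in X$, $\lambda,\tilde\lambda\in[0,1]$: (W1) $d(z,W(x,y,\lambda))\le(1-\lambda)d(z,x)+\lambda d(z,y)$; (W2) $d(W(x,y,\lambda),W(x,y,\tilde\lambda))=|\lambda-\tilde\lambda|\,d(x,y)$; (W3) $W(x,y,\lambda)=W(y,x,1-\lambda)$; (W4) $d(W(x,z,\lambda),W(y,w,\lambda))\le(1-\lambda)d(x,y)+\lambda d(z,w)$. Write $(1-\lambda)x\oplus\lambda y:=W(x,y,\lambda)$. A nonempty $C\subseteq X$ is convex if $(1-\lambda)x\oplus\lambda y\in C$ for all $x,y\in C$, $\lambda\in[0,1]$. $(X,d,W)$ is uniformly convex with modulus of uniform convexity $\eta:(0,\infty)\times(0,2]\to(0,1]$ if for all $r>0$, $\varepsilon\in(0,2]$, $a,x,y\in X$: $d(x,a)\le r$, $d(y,a)\le r$, $d(x,y)\ge\varepsilon r$ imply $d(\frac12x\oplus\frac12y,a)\le(1-\eta(r,\varepsilon))r$. The modulus $\eta$ is monotone if it decreases with $r$ for fixed $\varepsilon$ (i.e. $\eta(s,\varepsilon)\le\eta(r,\varepsilon)$ whenever $s\ge r$). A $UCW$-hyperbolic space is a uniformly convex $W$-hyperbolic space admitting a monotone modulus of uniform convexity.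 $T:C\to C$ is nonexpansive if $d(Tx,Ty)\le d(x,y)$ for all $x,y\in C$. *)

(* Defs.v *)
From HB Require Import structures.
From mathcomp Require Import all_boot all_order all_algebra.
From mathcomp Require Import all_classical all_reals all_analysis.

Set Implicit Arguments.
Unset Strict Implicit.
Unset Printing Implicit Defensive.

Import Order.TTheory GRing.Theory Num.Theory.

Local Open Scope classical_set_scope.
Local Open Scope ring_scope.

(* The completeType and cvg of the library require a pointed type, hence this
   predicate on an arbitrary metric space. *)
Definition complete_metric (R : realType) (X : metricType R) : Prop :=
  forall u : nat -> X, cauchy (u @ \oo) -> exists l : X, u @ \oo --> l.

(* The library's bounded_set is defined through a norm. *)
Definition metric_bounded (R : realType) (X : metricType R) (C : set X) : Prop :=
  exists M : R, forall x y, C x -> C y -> mdist x y <= M.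

(* W is a total function of its last argument, but only its values for
   l in [0, 1] are ever constrained or used; W x y l is (1 - l) x (+) l y. *)
Record W_hyperbolic (R : realType) (X : metricType R) (W : X -> X -> R -> X) :
    Prop := WHyperbolic {
  W_hyperbolic1 : forall (x y z : X) (l : R), 0 <= l <= 1 ->
    mdist z (W x y l) <= (1 - l) * mdist z x + l * mdist z y ;
  W_hyperbolic2 : forall (x y : X) (l l' : R), 0 <= l <= 1 -> 0 <= l' <= 1 ->
    mdist (W x y l) (W x y l') = `|l - l'| * mdist x y ;
  W_hyperbolic3 : forall (x y : X) (l : R), 0 <= l <= 1 ->
    W x y l = W y x (1 - l) ;
  W_hyperbolic4 : forall (x y z w : X) (l : R), 0 <= l <= 1 ->
    mdist (W x z l) (W y w l) <= (1 - l) * mdist x y + l * mdist z w }.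

Definition W_convex (R : realType) (X : metricType R) (W : X -> X -> R -> X)
    (C : set X) : Prop :=
  forall (x y : X) (l : R), C x -> C y -> 0 <= l <= 1 -> C (W x y l).

(* A modulus eta : (0, oo) x (0, 2] -> (0, 1] is encoded as a total function,
   whose values outside that domain are irrelevant. *)
Definition uc_modulus (R : realType) (X : metricType R) (W : X -> X -> R -> X)
    (eta : R -> R -> R) : Prop :=
  (forall r e : R, 0 < r -> 0 < e <= 2 -> 0 < eta r e <= 1) /\
  (forall (r e : R) (a x y : X), 0 < r -> 0 < e <= 2 ->
     mdist x a <= r -> mdist y a <= r -> e * r <= mdist x y ->
     mdist (W x y (1 / 2)) a <= (1 - eta r e) * r).

Definition monotone_modulus (R : realType) (eta : R -> R -> R) : Prop :=
  forall r s e : R, 0 < r -> r <= s -> 0 < e <= 2 -> eta s e <= eta r e.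

Definition UCW_hyperbolic (R : realType) (X : metricType R)
    (W : X -> X -> R -> X) : Prop :=
  W_hyperbolic W /\
  exists eta : R -> R -> R, uc_modulus W eta /\ monotone_modulus eta.

Definition nonexpansive (R : realType) (X : metricType R) (C : set X)
    (T : X -> X) : Prop :=
  forall x y, C x -> C y -> mdist (T x) (T y) <= mdist x y.

(* Main.v *)
(* Fix x in C and let the asymptotic radius of y in C be the limsup of
   d(T^n x, y). A midpoint of two points whose radii are close to the infimum
   rho and which stay a definite distance apart would have radius less than
   rho, by uniform convexity; monotonicity of the modulus makes the gain uniform
   as the radii decrease to rho. So near-minimizers of the radius are close to
   one another, and a minimizing sequence converges. As T does not increase the
   radius, the image of a minimizing sequence is again minimizing, so the limit
   is fixed by T. *)
Require Import Defs.
From mathcomp Require Import all_boot all_order all_algebra.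
From mathcomp Require Import all_classical all_reals all_analysis.
From mathcomp Require Import lra.

Import Order.TTheory GRing.Theory Num.Theory.
Import metricType_numDomainType.

Local Open Scope classical_set_scope.
Local Open Scope ring_scope.

(* [radius_le u y s] implies limsup d(u n, y) <= s, and follows from
   limsup d(u n, y) < s. *)
Definition radius_le {R : realType} {X : metricType R} (u : nat -> X) (y : X)
  (s : R) : Prop := \forall n \near \oo, mdist (u n) y <= s.

Lemma radius_leW {R : realType} {X : metricType R} (u : nat -> X) (y : X)
  (s t : R) : s <= t -> radius_le u y s -> radius_le u y t.
Proof. by move=> st; apply: filterS => n /le_trans; exact. Qed.

Lemma radius_le_ge0 {R : realType} {X : metricType R} (u : nat -> X) (y : X)
  (s : R) : radius_le u y s -> 0 <= s.
Proof. by move=> /filter_ex[n]; apply: le_trans; exact: mdist_ge0. Qed.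

Lemma dist_le_radius {R : realType} {X : metricType R} (u : nat -> X)
  (y z : X) (s t : R) :
  radius_le u y s -> radius_le u z t -> mdist y z <= s + t.
Proof.
move=> uy uz; have [n [yn zn]] := filter_ex (filterI uy uz).
by rewrite (le_trans (metric_triangle y (u n) z))// lerD// metric_sym.
Qed.

Lemma radius_le_midpoint {R : realType} {X : metricType R}
  (W : X -> X -> R -> X) (eta : R -> R -> R) (u : nat -> X) (y z : X)
  (s e : R) :
  uc_modulus W eta -> 0 < s -> 0 < e <= 2 -> e * s <= mdist y z ->
  radius_le u y s -> radius_le u z s ->
  radius_le u (W y z (1 / 2)) ((1 - eta s e) * s).
Proof.
move=> [_ uc] s0 e02 yz; apply: filterS2 => n yn zn.
by rewrite metric_sym; apply: uc => //; rewrite metric_sym.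
Qed.

Lemma near_minimizers_close {R : realType} {X : metricType R}
  (W : X -> X -> R -> X) (C : set X) (u : nat -> X) (rho : R) :
  UCW_hyperbolic W -> W_convex W C -> 0 <= rho ->
  (forall y s, C y -> radius_le u y s -> rho <= s) ->
  forall eps, 0 < eps -> exists2 d, 0 < d &
    forall y z, C y -> C z ->
      radius_le u y (rho + d) -> radius_le u z (rho + d) ->
      mdist y z < eps.
Proof.
move=> [_ [eta [uc mono]]] convC rho_ge0 rho_min eps eps0.
move: rho_ge0; rewrite le_eqVlt => /predU1P[rho0|rho0].
  (* If [rho = 0], the triangle inequality through a common [u n] gives
     [mdist y z <= 2 * eps / 3]. *)
  exists (eps / 3); first by lra.
  by move=> y z _ _ uy uz; have := dist_le_radius _ _ _ _ _ uy uz; lra.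
(* This makes [e * (rho + d) <= eps] for every [d <= 1]; the cap 2 keeps [e] in the domain of the
   modulus. *)
pose e := Num.min (eps / (rho + 1)) 2.
have e02 : 0 < e <= 2.
  by rewrite /e lt_min ge_min lexx orbT divr_gt0 ?ltr0n//; lra.
(* Evaluated at a radius independent of [d], so that [d] may depend on [h]; monotonicity gives
   [h <= eta (rho + d) e]. *)
pose h := eta (rho + 1) e.
have [etaP _] := uc.
have /andP[h0 h1] : 0 < h <= 1 by apply: etaP => //; lra.
have hrho0 : 0 < h * rho by rewrite mulr_gt0.
(* The second bound forces [(1 - h) * (rho + d) < rho], too small a radius for the midpoint. *)
exists (Num.min 1 (h * rho / 2)); first by rewrite lt_min ltr01/=; lra.
set d := Num.min _ _ => y z Cy Cz uy uz.
have d1 : d <= 1 by rewrite ge_min lexx.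
have dh : d <= h * rho / 2 by rewrite ge_min lexx orbT.
have d0 : 0 < d by rewrite lt_min ltr01/=; lra.
have s0 : 0 < rho + d by lra.
rewrite ltNge; apply/negP => yz.
have es : e * (rho + d) <= mdist y z.
  apply: le_trans yz; rewrite -[leRHS](divfK (_ : rho + 1 != 0)); last first.
    by rewrite gt_eqF//; lra.
  apply: ler_pM; [lra|lra| |lra].
  by rewrite ge_min lexx.
have Cm : C (W y z (1 / 2)) by apply: convC => //; lra.
have := rho_min _ _ Cm (radius_le_midpoint _ _ _ _ _ _ _ uc s0 e02 es uy uz).
have heta : h <= eta (rho + d) e by apply: mono => //; lra.
have : h * (rho + d) <= eta (rho + d) e * (rho + d).
  by rewrite ler_wpM2r// ltW.
have hd0 : 0 <= h * d by rewrite mulr_ge0 ?ltW.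
rewrite mulrDr mulrBl mul1r; lra.
Qed.

Theorem corollary3p7 (R : realType) (X : metricType R) (W : X -> X -> R -> X)
    (C : set X) (T : {fun C >-> C}) :
  complete_metric X -> UCW_hyperbolic W ->
  C !=set0 -> metric_bounded C -> W_convex W C -> closed C ->
  nonexpansive C T ->
  exists2 x : X, C x & T x = x.
Proof.
move=> complX ucW [x0 Cx0] [M CM] convC closedC nexpT.
have TC x : C x -> C (T x) by exact: funS.
pose u n := iter n T x0.
have Cu n : C (u n) by elim: n => //= n; exact: TC.
(* [inf A] is the infimum over [C] of the asymptotic radius, obtained without forming a limsup. *)
pose A : set R := [set s | exists2 y, C y & radius_le u y s].
have A0 : has_lbound A by exists 0 => s [y _ /radius_le_ge0].
have AM : A M by exists x0 => //; apply: nearW => n; exact: CM.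
pose rho := inf A.
have rho_min y s : C y -> radius_le u y s -> rho <= s.
  by move=> Cy us; apply: ge_inf => //; exists y.
have rho0 : 0 <= rho.
  by apply: lb_le_inf; [exists M|move=> s [y _ /radius_le_ge0]].
have minseq k : exists y, C y /\ radius_le u y (rho + k.+1%:R^-1).
  have [||s [y Cy us] sk] := @inf_adherent _ A k.+1%:R^-1.
  - by rewrite invr_gt0 ltr0n.
  - by split=> //; exists M.
  - by exists y; split=> //; apply: radius_leW us; exact: ltW.
have [y /all_and2[Cy uy]] := choice minseq.
have uyW d : 0 < d -> \forall k \near \oo, radius_le u (y k) (rho + d).
  move=> d0; have := near_infty_natSinv_lt (PosNum d0); apply: filterS => k kd.
  by apply: radius_leW (uy k); rewrite lerD2l ltW.
have close := near_minimizers_close _ _ _ _ ucW convC rho0 rho_min.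
have radiusT z s : C z -> radius_le u z s -> radius_le u (T z) s.
  (* Since [u n.+1 = T (u n)], the bound for [T z] starts one index later. *)
  move=> Cz [N _ uN]; exists N.+1 => // -[//|n] /= Nn.
  by apply: le_trans (uN n Nn); exact: nexpT.
have [l yl] : exists l : X, y @ \oo --> l.
  apply: complX; apply: cauchy_exP => e e0.
  have [d d0 dP] := close _ e0.
  have [N _ yN] := uyW _ d0.
  exists (y N); exists N => // n Nn; rewrite /= ballEmdist.
  by apply: dP => //; apply: yN => //=.
have Cl : C l by apply: (closed_cvg C closedC _ _ yl); exact: nearW.
exists l => //; apply: contrapT => /eqP; rewrite -mdist_gt0 => Tl.
(* Each leg of the path [T l], [T (y k)], [y k], [l] will be shorter than a third of
   [mdist (T l) l]. *)
have e0 : 0 < mdist (T l) l / 3 by lra.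
have [d d0 dP] := close _ e0.
have [k [uk lk]] := filter_ex (filterI (uyW _ d0) (cvgr_dist_lt yl e0)).
have Tyk := dP _ _ (TC _ (Cy k)) (Cy k) (radiusT _ _ (Cy k) uk) uk.
have := nexpT _ _ Cl (Cy k).
have := metric_triangle (T l) (T (y k)) l.
have := metric_triangle (T (y k)) (y k) l.
rewrite (metric_sym (y k) l); lra.
Qed.
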